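(* Let $\mathbf y=\{y_j\}_{j\in\mathbb Z}$, $\mathbf s=\{s_j\}_{j\in\mathbb Z}$ be complex parameters, and let $\Psi(u,\xi)$, $\Psi^*(\zeta,v)$ be the operators on the Fock space $\mathscr F$ defined on the basis by $$\Psi(u,\xi)\,e_{\mathcal T}=D^{\mathbb Z}(u,\sqrt{u/\xi})\,C^{\mathbb Z}(\xi,\sqrt{\xi/u})\,(-1)^{c(\mathcal T)}e_{\mathcal T},\qquad\Psi^*(\zeta,v)\,e_{\mathcal T}=D^{\mathbb Z}(\zeta,\sqrt{\zeta/v})\,B^{\mathbb Z}(v,\sqrt{v/\zeta})\,e_{\mathcal T}.$$ Then, as operators on $\mathscr F$, $$\Psi(u,\xi)=\sum_{j\in\mathbb Z}\frac{y_j(1-s_j^{-2})}{u-s_j^{-2}y_j}\,\mathcal P_{0,j-1}(u\mid\mathbf y;\mathbf s^{-2}\mathbf y)\,\psi_j,\qquad\Psi^*(\zeta,v)=\sum_{j\in\mathbb Z}\frac{v-\zeta}{v-y_j}\,\mathcal P_{0,j-1}(v\mid\mathbf s^{-2}\mathbf y;\mathbf y)\,\psi_j^*.$$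
   Context: Vertex weights. $W(\cdot)=W(\cdot\mid x;y;r;s)$, with arguments $(i_1,j_1;i_2,j_2)\in\{0,1\}^4$: $W(0,0;0,0)=1$, $W(1,1;1,1)=\frac{r^{-2}x-y}{s^{-2}y-x}$, $W(1,0;1,0)=\frac{s^{-2}y-r^{-2}x}{s^{-2}y-x}$, $W(0,1;0,1)=\frac{y-x}{s^{-2}y-x}$, $W(1,0;0,1)=\frac{x(r^{-2}-1)}{s^{-2}y-x}$, $W(0,1;1,0)=\frac{y(s^{-2}-1)}{s^{-2}y-x}$, and $W=0$ otherwise. The weights depend on $r$ only through $r^{-2}$, so branches of square roots do not matter. Fock space. $\mathcal T\subset\mathbb Z$ is semi-infinite if for some $M>0$, $i\notin\mathcal T$ for all $i>M$ and $i\in\mathcal T$ for all $i<-M$. Its charge is $c(\mathcal T)=\#(\mathcal T\cap\mathbb Z_{>0})-\#(\mathbb Z_{\le0}\setminus\mathcal T)$. $\mathscr F$ is spanned by vectors $e_{\mathcal T}$ over semi-infinite $\mathcal T$, with inner product $\langle e_{\mathcal T},e_{\mathcal R}\rangle=\mathbf 1_{\mathcal T=\mathcal R}$. Operators may produce formal infinite linear combinations; operator identities are understood as identities of all matrix elements $\langle\,\cdot\,e_{\mathcal T},e_{\mathcal R}\rangle$. Row operators. For $X\in\{B,C,D\}$, $\langle X^{\mathbb Z}(x,r)e_{\mathcal T},e_{\mathcal R}\rangle$ is defined as follows. Let $h_m\in\{0,1\}$, $m\in\mathbb Z$, satisfy $\mathbf 1_{m\in\mathcal T}+h_{m-1}=\mathbf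 1_{m\in\mathcal R}+h_m$ for all $m$, with $(\lim_{m\to-\infty}h_m,\lim_{m\to+\infty}h_m)$ equal to $(0,1)$ for $B$, $(1,0)$ for $C$, $(0,0)$ for $D$. If such (necessarily unique) $h$ exists, the matrix element is $\prod_{m\in\mathbb Z}W(\mathbf 1_{m\in\mathcal T},h_{m-1};\mathbf 1_{m\in\mathcal R},h_m\mid x;y_m;r;s_m)/n_m$ (only finitely many factors differ from $1$); otherwise it is $0$. The normalizations, with weights evaluated at $(x;y_m;r;s_m)$, are: for $B$: $n_m=W(1,0;1,0)$ if $m\le0$ and $n_m=W(0,1;0,1)$ if $m\ge1$; for $C$: $n_m=W(1,1;1,1)$ if $m\le0$ and $n_m=1$ if $m\ge1$; for $D$: $n_m=W(1,0;1,0)$ if $m\le0$ and $n_m=1$ if $m\ge1$. Creation and annihilation operators. $\psi_je_{\mathcal T}=(-1)^{\#\{t\in\mathcal T:t>j\}}e_{\mathcal T\cup\{j\}}$ if $j\notin\mathcal T$ and $0$ otherwise; $\psi_j^*e_{\mathcal T}=(-1)^{\#\{t\in\mathcal T:t>j\}}e_{\mathcal T\setminus\{j\}}$ if $j\in\mathcal T$ and $0$ otherwise. Inhomogeneous powers. $\mathcal P_{n,n'}(u\mid\mathbf b;\mathbf c)=\prod_{j=n+1}^{n'}\frac{u-b_j}{u-c_j}$ if $n<n'$; $=1$ if $n=n'$; $=\prod_{j=n'+1}^{n}\frac{u-c_j}{u-b_j}$ if $n>n'$. Here $\mathbf s^{-2}\mathbf y=\{s_j^{-2}y_j\}$. The variables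 $u,\xi,\zeta,v$ are nonzero complex numbers, and all parameters are assumed such that no denominator vanishes. *)

(* Defs.v *)
From HB Require Import structures.
From mathcomp Require Import all_boot all_order all_algebra finmap.
From mathcomp Require Import mathcomp_extra boolp classical_sets functions.
From mathcomp Require Import cardinality fsbigop reals complex.

Set Implicit Arguments.
Unset Strict Implicit.
Unset Printing Implicit Defensive.

Import Order.TTheory GRing.Theory Num.Theory.

Local Open Scope classical_set_scope.
Local Open Scope ring_scope.

(** Infinite sums and products over [int] or over [fock_state] are written with
    the finitely supported big operators of [fsbigop]: [\sum_(i \in A) F i]
    ranges over the [i] in [A] with [F i != 0], and [\big[*%R/1]_(i \in A) F i]
    over those with [F i != 1].  If there are infinitely many such [i] the value
    is by convention the neutral element; under the hypotheses of the theorem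
    this never happens for the families used below. *)

Definition semi_infinite (T : set int) : Prop :=
  exists M : int,
    [/\ 0 < M, forall i : int, M < i -> ~ T i & forall i : int, i < - M -> T i].

(** A state [T] indexes the basis vector e_T of the Fock space. *)
Record fock_state := FockState {
  occ : set int;
  occ_semi_infinite : semi_infinite occ }.

HB.instance Definition _ := gen_eqMixin fock_state.
HB.instance Definition _ := gen_choiceMixin fock_state.

(** [#|` fset_set A|] is the cardinality of a finite set [A]; both sets below
    are finite because [T] is semi-infinite. *)
Definition charge (T : fock_state) : int :=
  (#|` fset_set (occ T `&` [set t | 0 < t])|)%:Z -
  (#|` fset_set ([set t | t <= 0] `\` occ T)|)%:Z.

Section FockOperators.
Variable C : numClosedFieldType.

(** The weight W(i1, j1; i2, j2 | x; y; r; s). *)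
Definition vertex_weight (i1 j1 i2 j2 : bool) (x y r s : C) : C :=
  match i1, j1, i2, j2 with
  | false, false, false, false => 1
  | true,  true,  true,  true  => (r ^- 2 * x - y) / (s ^- 2 * y - x)
  | true,  false, true,  false => (s ^- 2 * y - r ^- 2 * x) / (s ^- 2 * y - x)
  | false, true,  false, true  => (y - x) / (s ^- 2 * y - x)
  | true,  false, false, true  => (x * (r ^- 2 - 1)) / (s ^- 2 * y - x)
  | false, true,  true,  false => (y * (s ^- 2 - 1)) / (s ^- 2 * y - x)
  | _, _, _, _ => 0
  end.

(** An operator is given by its matrix elements: [A T R] is <A e_T, e_R>, so
    that [A T] lists the coefficients of the formal, possibly infinite, linear
    combination A e_T. *)
Definition fock_op := fock_state -> fock_state -> C.

(** The operator A B, in which B acts first. *)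
Definition fock_comp (A B : fock_op) : fock_op := fun T R =>
  \sum_(S \in [set: fock_state]) B T S * A S R.

Inductive row_kind := RowB | RowC | RowD.

Definition row_left (X : row_kind) : bool :=
  match X with RowB => false | RowC => true | RowD => false end.

Definition row_right (X : row_kind) : bool :=
  match X with RowB => true | RowC => false | RowD => false end.

(** Conservation at every vertex, and the limits of [h] at both infinities;
    as [h] takes values in {0,1}, having a limit means being eventually
    constant. *)
Definition row_path (X : row_kind) (T R : fock_state) (h : int -> bool) : Prop :=
  [/\ forall m : int,
        ((m \in occ T) + h (m - 1)%R = (m \in occ R) + h m)%N,
      exists M : int, forall m : int, m <= M -> h m = row_left X
    & exists M : int, forall m : int, M <= m -> h m = row_right X].

Definition row_norm (X : row_kind) (m : int) (x y r s : C) : C :=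
  match X with
  | RowB => if m <= 0 then vertex_weight true false true false x y r s
            else vertex_weight false true false true x y r s
  | RowC => if m <= 0 then vertex_weight true true true true x y r s else 1
  | RowD => if m <= 0 then vertex_weight true false true false x y r s else 1
  end.

Definition row_op (y s : int -> C) (X : row_kind) (x r : C) : fock_op :=
  fun T R =>
  match pselect (exists h, row_path X T R h) with
  | left path_ex =>
      let h := projT1 (cid path_ex) in
      \big[*%R/1]_(m \in [set: int])
        (vertex_weight (m \in occ T) (h (m - 1)) (m \in occ R) (h m)
           x (y m) r (s m) / row_norm X m x (y m) r (s m))
  | right _ => 0
  end.

Definition fermion_sign (j : int) (T : fock_state) : C :=
  (-1) ^+ #|` fset_set (occ T `&` [set t | j < t])|.

Definition psi (j : int) : fock_op := fun T R =>
  if `[< ~ occ T j /\ occ R = occ T `|` [set j] >] then fermion_sign j T else 0.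

Definition psi_star (j : int) : fock_op := fun T R =>
  if `[< occ T j /\ occ R = occ T `\` [set j] >] then fermion_sign j T else 0.

(** The product over n < j <= n' is indexed by j = n + 1 + k. *)
Definition inhom_pow (n n' : int) (u : C) (b c : int -> C) : C :=
  if n <= n' then
    \prod_(k < `|n' - n|%N) ((u - b (n + 1 + k%:Z)) / (u - c (n + 1 + k%:Z)))
  else
    \prod_(k < `|n - n'|%N) ((u - c (n' + 1 + k%:Z)) / (u - b (n' + 1 + k%:Z))).

Definition Psi (y s : int -> C) (u xi : C) : fock_op := fun T R =>
  (-1) ^ charge T *
  fock_comp (row_op y s RowD u (sqrtC (u / xi)))
            (row_op y s RowC xi (sqrtC (xi / u))) T R.

Definition Psi_star (y s : int -> C) (zeta v : C) : fock_op :=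
  fock_comp (row_op y s RowD zeta (sqrtC (zeta / v)))
            (row_op y s RowB v (sqrtC (v / zeta))).

End FockOperators.

(* Main.v *)
Require Import Defs.
From HB Require Import structures.
From mathcomp Require Import all_boot all_order all_algebra finmap.
From mathcomp Require Import mathcomp_extra boolp classical_sets functions.
From mathcomp Require Import cardinality fsbigop reals complex.
From mathcomp Require Import zify ring.

Import Order.TTheory GRing.Theory Num.Theory.
Local Open Scope classical_set_scope.
Local Open Scope ring_scope.

(** Superposing the two rows, a matrix element of Psi or Psi* becomes a product
    of transfer matrices, one per site, acting on the pair (h, h') of horizontal
    edges of the lower and the upper row; the intermediate state is summed over
    site by site. Since the two rows carry the spectral parameters (x, z) and
    (z, x), these 4x4 matrices have two triangularity properties. For Psi, the
    functional "sum of the (1,0) and (0,1) coordinates" is an eigenfunctional at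
    every site with equal occupations, and is killed when the total h + h'
    changes into 1; for Psi*, the span of (0,0) and of the difference
    (1,0) - (0,1) is invariant. Either way only a scalar 2x2 triangular
    recurrence is left, whose solution is a sum over the single site j where the
    occupations differ. Up to the normalizations, the other sites contribute 1 on
    one side of j, and an inhomogeneous power times a fermionic sign on the
    other. *)

(* The window of sites [- N < m <= L - N] is numbered by [k < L]. *)
Definition site (N k : nat) : int := k%:Z - N%:Z + 1.

Lemma site_inj (N : nat) : injective (site N).
Proof. by rewrite /site => i j; lia. Qed.

Lemma siteP (N L : nat) (m : int) :
  - N%:Z < m -> m <= L%:Z - N%:Z -> exists2 k : nat, (k < L)%N & m = site N k.
Proof.
by rewrite /site => m_gt m_le; exists (absz (m + N%:Z - 1)%R); lia.
Qed.

(** On an infinite support the big operator defaults to [idx]; neutrality outside the window rules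
    this out. The law stays abstract because rows need the product and the final expansions the
    sum. *)
Lemma fsbig_site (V : Type) (idx : V) (op : Monoid.com_law idx) (N L : nat)
    (f : int -> V) :
  (forall m : int, m <= - N%:Z -> f m = idx) ->
  (forall m : int, L%:Z - N%:Z < m -> f m = idx) ->
  \big[op/idx]_(m \in [set: int]) f m = \big[op/idx]_(k < L) f (site N k).
Proof.
move=> f_low f_high; rewrite (fsbigE [seq site N k | k <- iota 0 L]) //=.
- by under eq_bigl do rewrite in_setT; rewrite big_map -{1}[L]subn0 big_mkord.
- by rewrite map_inj_uniq ?iota_uniq //; apply: site_inj.
- move=> m _ m_out; have [m_le|m_gt] := lerP m (- N%:Z); first exact: f_low.
  have [m_le|m_gt2] := lerP m (L%:Z - N%:Z); last exact: f_high.
  have [k kL m_site] := siteP N L m m_gt m_le.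
  by rewrite m_site map_f ?mem_iota in m_out.
Qed.

(** * States and row paths that are trivial outside a window *)

Definition windowed (N L : nat) (T : fock_state) : Prop :=
  (forall m : int, m <= - N%:Z -> m \in occ T) /\
  (forall m : int, L%:Z - N%:Z < m -> m \notin occ T).

Lemma windowed_common (T S : fock_state) :
  exists N : nat,
    [/\ (0 < N)%N, windowed N (N + N) T & windowed N (N + N) S].
Proof.
have [M [M_gt0 T_hi T_lo]] := occ_semi_infinite T.
have [M' [M'_gt0 S_hi S_lo]] := occ_semi_infinite S.
exists (absz M + absz M' + 1)%N; split; [lia| |]; split => m m_bound.
- by rewrite in_setE; apply: T_lo; lia.
- by apply/negP; rewrite in_setE; apply: T_hi; lia.
- by rewrite in_setE; apply: S_lo; lia.
- by apply/negP; rewrite in_setE; apply: S_hi; lia.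
Qed.

Lemma fock_state_eqP (T S : fock_state) :
  (forall m : int, (m \in occ T) = (m \in occ S)) -> T = S.
Proof.
case: T S => [A A_si] [B B_si] /= AB.
have eqAB : A = B.
  by apply/seteqP; split=> m /mem_set m_in; apply: set_mem; rewrite ?AB // -AB.
by case: _ / eqAB B_si {AB} => B_si; rewrite (Prop_irrelevance A_si B_si).
Qed.

(** Equal occupations at [m] force [h m = h (m - 1)], so the limit value propagates to the right,
    starting from the threshold [M]. *)
Lemma row_path_low (X : row_kind) (N : nat) (T S : fock_state) (h : int -> bool) :
  row_path X T S h ->
  (forall m : int, m <= - N%:Z -> (m \in occ T) = (m \in occ S)) ->
  forall m : int, m <= - N%:Z -> h m = row_left X.
Proof.
move=> [h_cons [M h_lim] _] TS.
have step (n : nat) (m : int) : m <= - N%:Z -> m <= M + n%:Z -> h m = row_left X.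
  elim: n m => [|n IHn] m m_le m_le_M; first by apply: h_lim; lia.
  have := h_cons m; rewrite TS // (IHn (m - 1)); [|lia|lia].
  by move/addnI; case: (h m); case: (row_left X).
by move=> m m_le; apply: (step (absz (m - M)%R)) => //; lia.
Qed.

Lemma row_path_high (X : row_kind) (N L : nat) (T S : fock_state)
    (h : int -> bool) :
  row_path X T S h ->
  (forall m : int, L%:Z - N%:Z < m -> (m \in occ T) = (m \in occ S)) ->
  forall m : int, L%:Z - N%:Z <= m -> h m = row_right X.
Proof.
move=> [h_cons _ [M h_lim]] TS.
have step (n : nat) (m : int) :
    L%:Z - N%:Z <= m -> M - n%:Z <= m -> h m = row_right X.
  elim: n m => [|n IHn] m m_le m_le_M; first by apply: h_lim; lia.
  have := h_cons (m + 1); rewrite addrK TS ?(IHn (m + 1)); [|lia|lia|lia].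
  by move/addnI; case: (h m); case: (row_right X).
by move=> m m_le; apply: (step (absz (m - M)%R)) => //; lia.
Qed.

(* A D-path has no incoming arrow on either side, so it can neither empty a
   site on the far left nor fill one on the far right. *)
Lemma row_path_D_windowed (N L : nat) (T S : fock_state) (h : int -> bool) :
  row_path RowD S T h -> windowed N L T -> windowed N L S.
Proof.
move=> [h_cons [M h_lo] [M' h_hi]] [T_lo T_hi].
have h_low (n : nat) (m : int) : m <= - N%:Z -> m <= M + n%:Z -> h m = false.
  elim: n m => [|n IHn] m m_le m_le_M; first by apply: h_lo; lia.
  have := h_cons m; rewrite T_lo // (IHn (m - 1)); [|lia|lia].
  by case: (m \in occ S); case: (h m).
have h_high (n : nat) (m : int) :
    L%:Z - N%:Z <= m -> M' - n%:Z <= m -> h m = false.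
  elim: n m => [|n IHn] m m_le m_le_M; first by apply: h_hi; lia.
  have := h_cons (m + 1); rewrite addrK (IHn (m + 1)); [|lia|lia].
  have /negbTE -> := T_hi (m + 1) ltac:(lia).
  by case: (_ \in occ S); case: (h m).
split=> m m_bound.
- have := h_cons m; rewrite T_lo //.
  rewrite (h_low (absz (m - M)%R) m) // ?(h_low (absz (m - M)%R) (m - 1));
    [|lia..].
  by case: (m \in occ S).
- have := h_cons m; have /negbTE -> := T_hi m m_bound.
  rewrite (h_high (absz (m - M')%R).+1 m) //
    ?(h_high (absz (m - M')%R).+1 (m - 1)); [|lia..].
  by case: (m \in occ S).
Qed.

(** * Rows as finite products of matrices *)

Section RowSum.
Context {F : fieldType}.

(** An entry of a product of 2x2 transfer matrices. Summing over all edges lets columns be treated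
    one at a time, although for weights obeying conservation at most one term is nonzero. *)
Fixpoint row_sum (w : nat -> bool -> bool -> bool -> bool -> F)
    (t s : nat -> bool) (h : bool) (L : nat) (e : bool) : F :=
  if L is L'.+1 then
    \sum_(g : bool) row_sum w t s h L' g * w L' (t L') g (s L') e
  else (h == e)%:R.

Variable w : nat -> bool -> bool -> bool -> bool -> F.
Hypothesis w_cons : forall k (i1 j1 i2 j2 : bool),
  (i1 + j1 != i2 + j2)%N -> w k i1 j1 i2 j2 = 0.

(** Conservation determines each edge from the one on its left, so at every column only the summand
    [g = p L] survives. *)
Lemma row_sum_path (t s p : nat -> bool) (L : nat) :
  (forall k, (k < L)%N -> (t k + p k = s k + p k.+1)%N) ->
  forall e, row_sum w t s (p 0%N) L e =
    (p L == e)%:R * \prod_(k < L) w k (t k) (p k) (s k) (p k.+1).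
Proof.
elim: L => [|L IHL] p_cons e; first by rewrite big_ord0 mulr1.
have {}IHL := IHL (fun k kL => p_cons k (ltnW kL)).
rewrite /= (bigD1 (p L)) //= big1 => [|g /negbTE g_neq]; last first.
  by rewrite IHL eq_sym g_neq !mul0r.
rewrite IHL eqxx mul1r addr0 big_ord_recr /=.
have [<-|p_neq] := eqVneq (p L.+1) e; first by rewrite mul1r.
rewrite w_cons ?mulr0 ?mul0r // p_cons //.
by move: p_neq; case: (s L); case: (p L.+1); case: e.
Qed.

(** The converse direction, which makes the finite sum vanish whenever [row_op] is 0 for lack of a
    path. *)
Lemma row_sum_neq0 (t s : nat -> bool) (h e : bool) (L : nat) :
  row_sum w t s h L e != 0 ->
  exists p : nat -> bool, [/\ p 0%N = h, p L = e &
    forall k, (k < L)%N -> (t k + p k = s k + p k.+1)%N].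
Proof.
elim: L e => [|L IHL] e /=.
  by case: (eqVneq h e) => [<- _|_]; [exists (fun=> h) | rewrite eqxx].
rewrite big_bool /= => sum_neq0.
have [g] : exists g, row_sum w t s h L g * w L (t L) g (s L) e != 0.
  case: (eqVneq (row_sum w t s h L true * w L (t L) true (s L) e) 0) => [z|nz].
    by exists false; rewrite z add0r in sum_neq0.
  by exists true.
rewrite mulf_eq0 negb_or => /andP[/IHL[p [p0 pL p_cons]] w_neq0].
exists (fun k => if (k <= L)%N then p k else e); split=> [//||k].
- by rewrite ltnn.
- rewrite ltnS => k_le /=; rewrite k_le; have [k_lt|k_ge] := ltnP k L.
    exact: p_cons.
  have -> : k = L by apply/eqP; rewrite eqn_leq k_le.
  by rewrite pL; apply/eqP; apply: contraNT w_neq0 => /w_cons ->; rewrite eqxx.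
Qed.

End RowSum.

Definition occ_at (N : nat) (T : fock_state) (k : nat) : bool :=
  site N k \in occ T.

Section RowOp.
Context {F : numClosedFieldType}.
Variables (y s : int -> F) (X : row_kind) (x r : F).

Definition normalized_weight (N k : nat) (i1 j1 i2 j2 : bool) : F :=
  vertex_weight i1 j1 i2 j2 x (y (site N k)) r (s (site N k)) /
  row_norm X (site N k) x (y (site N k)) r (s (site N k)).

Lemma normalized_weight_cons (N k : nat) (i1 j1 i2 j2 : bool) :
  (i1 + j1 != i2 + j2)%N -> normalized_weight N k i1 j1 i2 j2 = 0.
Proof.
by case: i1; case: j1; case: i2; case: j2 => //= _;
  rewrite /normalized_weight /= mul0r.
Qed.

Hypothesis norm_neq0 :
  forall m : int, row_norm X m x (y m) r (s m) != 0.

(** Outside the window the edges sit at their limits, and each factor is the normalization divided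
    by itself. The bound [N <= L] makes all sites left of the window at most 0 and all sites right
    of it at least 1, so the right branch of [row_norm] applies on each side. *)
Lemma row_op_window (N L : nat) (T S : fock_state) :
  (0 < N <= L)%N -> windowed N L T -> windowed N L S ->
  row_op y s X x r T S =
  row_sum (normalized_weight N) (occ_at N T) (occ_at N S)
          (row_left X) L (row_right X).
Proof.
move=> /andP[N_gt0 NL] [T_lo T_hi] [S_lo S_hi].
have TS_lo (m : int) : m <= - N%:Z -> (m \in occ T) = (m \in occ S).
  by move=> m_le; rewrite T_lo // S_lo.
have TS_hi (m : int) : L%:Z - N%:Z < m -> (m \in occ T) = (m \in occ S).
  by move=> m_gt; rewrite (negbTE (T_hi m m_gt)) (negbTE (S_hi m m_gt)).
rewrite /row_op; case: pselect => [path_ex|no_path]; last first.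
  apply/esym/eqP; apply: contra_notT no_path.
  move=> /(row_sum_neq0 _ (normalized_weight_cons N))[p [p0 pL p_cons]].
  (* Edge number [k] of the window is the integer [k - N], the left edge of [site N k]; hence the
     shift by [N]. Outside, the path is continued by its limits. *)
  exists (fun m : int => if m <= - N%:Z then row_left X else
            if L%:Z - N%:Z <= m then row_right X else p (absz (m + N%:Z)%R)).
  split=> [m||].
  - have [m_le|m_gt] := lerP m (- N%:Z).
      by rewrite TS_lo // !ifT //; lia.
    have [m_le|m_gt2] := lerP m (L%:Z - N%:Z); last first.
      have m_nle : (m - 1 <= - N%:Z) = false by lia.
      have m_nle' : (m <= - N%:Z) = false by lia.
      by rewrite TS_hi // m_nle !ifT //; lia.
    have [k kL m_site] := siteP N L m m_gt m_le; subst m.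
    have := p_cons k kL; rewrite /occ_at.
    have -> : (if site N k - 1 <= - N%:Z then row_left X else
      if L%:Z - N%:Z <= site N k - 1 then row_right X
      else p (absz (site N k - 1 + N%:Z)%R)) = p k.
      rewrite /site; case: ifP => [le_k|gt_k].
        by rewrite -p0; congr p; lia.
      by rewrite ifF; [congr p|]; lia.
    move=> ->; congr (_ + nat_of_bool _)%N.
    by rewrite -pL /site; case: ifP => le_k; congr p; lia.
  - by exists (- N%:Z) => m ->.
  - by exists (L%:Z - N%:Z + 1) => m m_ge; rewrite ifF ?ifT //; lia.
move: (projT1 _) (projT2 (cid path_ex)) => h h_path.
have h_lo := row_path_low _ _ _ _ _ h_path TS_lo.
have h_hi := row_path_high _ _ _ _ _ _ h_path TS_hi.
have [h_cons _ _] := h_path.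
rewrite (@fsbig_site _ _ _ N L) => [|m m_le|m m_gt].
- have edge (k : nat) : site N k - 1 = k%:Z - N%:Z by rewrite /site; lia.
  have edgeS (k : nat) : site N k = k.+1%:Z - N%:Z by rewrite /site; lia.
  have := @row_sum_path _ _ (normalized_weight_cons N) (occ_at N T)
    (occ_at N S) (fun k => h (k%:Z - N%:Z)) L.
  rewrite h_lo ?h_hi //; last by lia.
  move=> -> => [|k kL]; last by rewrite -edge -edgeS /occ_at h_cons.
  rewrite eqxx mul1r; apply: eq_bigr => k _.
  by rewrite /normalized_weight /occ_at edge -edgeS.
- have := norm_neq0 m.
  rewrite T_lo // S_lo // !h_lo; [|lia|lia].
  have -> : row_norm X m x (y m) r (s m) =
      vertex_weight true (row_left X) true (row_left X) x (y m) r (s m).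
    by rewrite /row_norm; case: (X); rewrite ifT //; lia.
  by move=> w_neq0; rewrite divff.
- have := norm_neq0 m.
  rewrite (negbTE (T_hi m m_gt)) (negbTE (S_hi m m_gt)) !h_hi; [|lia|lia].
  have -> : row_norm X m x (y m) r (s m) =
      vertex_weight false (row_right X) false (row_right X) x (y m) r (s m).
    by rewrite /row_norm; case: (X); rewrite ifF //; lia.
  by move=> w_neq0; rewrite divff.
Qed.

End RowOp.

(** * Enumeration of the states confined to a window *)

Lemma set_site_semi_infinite (m : int) (b : bool) (T : fock_state) :
  semi_infinite [set i | if i == m then b else i \in occ T].
Proof.
have [M [M_gt0 T_hi T_lo]] := occ_semi_infinite T.
exists (M + `|m|); split=> [|i i_gt|i i_lt] /=; first by lia.
- by rewrite ifF; [rewrite in_setE; apply: T_hi|]; lia.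
- by rewrite ifF; [rewrite in_setE; apply: T_lo|]; lia.
Qed.

Definition set_site (m : int) (T : fock_state) (b : bool) : fock_state :=
  FockState (set_site_semi_infinite m b T).

Lemma mem_set_site (m : int) (T : fock_state) (b : bool) (i : int) :
  (i \in occ (set_site m T b)) = (if i == m then b else i \in occ T).
Proof. by apply/idP/idP => [/set_mem|i_in]; last exact: mem_set. Qed.

Lemma vacuum_semi_infinite (m : int) : semi_infinite [set i : int | i <= m].
Proof. by exists (`|m| + 1); split=> [|i|i] /=; lia. Qed.

Definition vacuum (m : int) : fock_state := FockState (vacuum_semi_infinite m).

Lemma mem_vacuum (m i : int) : (i \in occ (vacuum m)) = (i <= m).
Proof. by apply/idP/idP => [/set_mem|i_in]; last exact: mem_set. Qed.

Fixpoint fock_window (N L : nat) : seq fock_state :=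
  if L is L'.+1 then
    [seq set_site (site N L') T b | T <- fock_window N L', b <- [:: true; false]]
  else [:: vacuum (- N%:Z)].

Lemma fock_windowS (N L : nat) : fock_window N L.+1 =
  [seq set_site (site N L) T b | T <- fock_window N L, b <- [:: true; false]].
Proof. by []. Qed.

Lemma mem_fock_window (N L : nat) (T : fock_state) :
  reflect (windowed N L T) (T \in fock_window N L).
Proof.
elim: L T => [|L IHL] T.
  rewrite inE; apply: (iffP eqP) => [->|[T_lo T_hi]].
    by split=> m; rewrite mem_vacuum; lia.
  apply: fock_state_eqP => m; rewrite mem_vacuum.
  by have [/T_lo//|m_gt] := lerP; apply/negbTE/T_hi; lia.
rewrite fock_windowS.
apply: (iffP allpairsP) => [[[S b] /= [/IHL[S_lo S_hi] _ ->]]|[T_lo T_hi]].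
  split=> m m_bound; rewrite mem_set_site ifF.
  - by apply: S_lo.
  - by move: m_bound; rewrite /site; lia.
  - by apply: S_hi; lia.
  - by move: m_bound; rewrite /site; lia.
(* Emptying the last site gives a state of the smaller window; its occupation is recorded
   separately. *)
exists (set_site (site N L) T false, site N L \in occ T); split=> /=.
- apply/IHL; split=> m m_bound; rewrite mem_set_site.
    by rewrite ifF ?T_lo //; move: m_bound; rewrite /site; lia.
  by case: eqVneq => // m_neq; apply: T_hi; move: m_neq m_bound; rewrite /site; lia.
- by case: (site N L \in _).
- by apply: fock_state_eqP => m; rewrite !mem_set_site; case: eqVneq => [->|].
Qed.

(** States of the smaller window are empty at [site N L], so both the state and the bit can be read
    off from [set_site]. *)
Lemma fock_window_uniq (N L : nat) : uniq (fock_window N L).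
Proof.
elim: L => [//|L IHL]; rewrite fock_windowS.
apply: allpairs_uniq => // p1 p2 p1_in p2_in.
have [[S1 b1] /= [/mem_fock_window[_ S1_hi] _ ->]] := allpairsP p1_in.
have [[S2 b2] /= [/mem_fock_window[_ S2_hi] _ ->]] := allpairsP p2_in.
move=> /= eq_set.
have site_hi : L%:Z - N%:Z < site N L by rewrite /site; lia.
have eq_mem m : (if m == site N L then b1 else m \in occ S1) =
    (if m == site N L then b2 else m \in occ S2).
  by rewrite -!mem_set_site eq_set.
have -> : b1 = b2 by have := eq_mem (site N L); rewrite eqxx.
congr pair; apply: fock_state_eqP => m; have := eq_mem m.
case: eqVneq => // ->.
by rewrite (negbTE (S1_hi _ site_hi)) (negbTE (S2_hi _ site_hi)).
Qed.

Lemma occ_at_set_site (N L k : nat) (T : fock_state) (b : bool) :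
  occ_at N (set_site (site N L) T b) k = if k == L then b else occ_at N T k.
Proof. by rewrite /occ_at mem_set_site (inj_eq (@site_inj N)). Qed.

(** * Two-row transfer matrices *)

Section TwoRowSum.
Context {F : fieldType}.
Implicit Types w : nat -> bool -> bool -> bool -> bool -> F.

Lemma eq_row_sum w (t t' s s' : nat -> bool) (h e : bool) (L : nat) :
  (forall k, (k < L)%N -> t k = t' k) -> (forall k, (k < L)%N -> s k = s' k) ->
  row_sum w t s h L e = row_sum w t' s' h L e.
Proof.
elim: L e => //= L IHL e tt' ss'; apply: eq_bigr => g _.
rewrite tt' // ss' // (IHL g) // => k kL; [apply: tt' | apply: ss'];
  exact: ltnW.
Qed.

Definition two_row_sum w1 w2 (N : nat) (t r : nat -> bool) (h h' : bool)
    (L : nat) (e e' : bool) : F :=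
  \sum_(S <- fock_window N L)
    row_sum w1 t (occ_at N S) h L e * row_sum w2 (occ_at N S) r h' L e'.

Lemma two_row_sum0 w1 w2 (N : nat) (t r : nat -> bool) (h h' e e' : bool) :
  two_row_sum w1 w2 N t r h h' 0 e e' = (h == e)%:R * (h' == e')%:R.
Proof. by rewrite /two_row_sum big_seq1. Qed.

(* [v] is a vector indexed by the two horizontal edges left of the column. *)
Definition column_transfer (v : bool -> bool -> F)
    (w1 w2 : bool -> bool -> bool -> bool -> F) (t r e e' : bool) : F :=
  \sum_(b : bool) \sum_(g : bool) \sum_(g' : bool)
    v g g' * (w1 t g b e * w2 b g' r e').

(** The first [L] columns do not see the occupation of [site N L], so the sum over the smaller
    window factors out and only the bit at the last site remains to be summed. *)
Lemma two_row_sumS w1 w2 (N : nat) (t r : nat -> bool) (h h' : bool) (L : nat)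
    (e e' : bool) :
  two_row_sum w1 w2 N t r h h' L.+1 e e' =
  column_transfer (two_row_sum w1 w2 N t r h h' L) (w1 L) (w2 L) (t L) (r L) e e'.
Proof.
rewrite /two_row_sum fock_windowS big_allpairs_dep exchange_big /=.
rewrite /column_transfer big_cons big_seq1 big_bool.
have term (b : bool) :
    \sum_(S <- fock_window N L)
      (\sum_(g : bool) row_sum w1 t (occ_at N (set_site (site N L) S b)) h L g *
         w1 L (t L) g (occ_at N (set_site (site N L) S b) L) e) *
      (\sum_(g' : bool) row_sum w2 (occ_at N (set_site (site N L) S b)) r h' L g' *
         w2 L (occ_at N (set_site (site N L) S b) L) g' (r L) e') =
    \sum_(g : bool) \sum_(g' : bool)
      (\sum_(S <- fock_window N L) row_sum w1 t (occ_at N S) h L g *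
         row_sum w2 (occ_at N S) r h' L g') *
      (w1 L (t L) g b e * w2 L b g' (r L) e').
  under [RHS]eq_bigr => g _.
    under eq_bigr => g' _ do rewrite mulr_suml.
    rewrite exchange_big; over.
  rewrite exchange_big; apply: eq_bigr => S _; rewrite mulr_suml.
  apply: eq_bigr => g _; rewrite mulr_sumr; apply: eq_bigr => g' _.
  have off k : (k < L)%N -> occ_at N (set_site (site N L) S b) k = occ_at N S k.
    by move=> kL; rewrite occ_at_set_site ltn_eqF.
  rewrite occ_at_set_site eqxx (eq_row_sum w1 t t _ (occ_at N S)) //.
  rewrite (eq_row_sum w2 _ (occ_at N S) r r) //. exact: mulrACA.
by rewrite -!term.
Qed.

End TwoRowSum.

(** * Composition of a D row with another row as a finite two-row sum *)

Section FockComp.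
Context {F : numClosedFieldType}.
Variables (y s : int -> F) (X : row_kind) (x x' r r' : F).
Hypothesis norm_neq0 : forall m : int, row_norm X m x (y m) r (s m) != 0.
Hypothesis normD_neq0 : forall m : int, row_norm RowD m x' (y m) r' (s m) != 0.

(** The intermediate state is joined to [R] by a D-path, so [row_path_D_windowed] confines it to the
    window of [R] and the sum over all states becomes finite. *)
Lemma fock_comp_window (N L : nat) (T R : fock_state) :
  (0 < N <= L)%N -> windowed N L T -> windowed N L R ->
  fock_comp (row_op y s RowD x' r') (row_op y s X x r) T R =
  two_row_sum (normalized_weight y s X x r N)
    (normalized_weight y s RowD x' r' N) N (occ_at N T) (occ_at N R)
    (row_left X) false L (row_right X) false.
Proof.
move=> NL T_win R_win.
rewrite /fock_comp (fsbigE (fock_window N L)) ?fock_window_uniq //=.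
- under eq_bigl do rewrite in_setT.
  apply: eq_big_seq => S /mem_fock_window S_win.
  by rewrite (row_op_window _ _ X _ _ _ N L) // (row_op_window _ _ RowD _ _ _ N L).
- move=> S _ /mem_fock_window S_out; rewrite {2}/row_op.
  case: pselect => [[h h_path]|_]; last by rewrite mulr0.
  by case: S_out; apply: row_path_D_windowed h_path R_win.
Qed.

End FockComp.

(* The vertex weight at [r = sqrt (x / z)], with [c] for [s ^- 2 * y]. *)
Definition column_weight {F : fieldType} (x z y c : F) (i1 j1 i2 j2 : bool) : F :=
  match i1, j1, i2, j2 with
  | false, false, false, false => 1
  | true,  true,  true,  true  => (z - y) / (c - x)
  | true,  false, true,  false => (c - z) / (c - x)
  | false, true,  false, true  => (y - x) / (c - x)
  | true,  false, false, true  => (z - x) / (c - x)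
  | false, true,  true,  false => (c - y) / (c - x)
  | _, _, _, _ => 0
  end.

(** Only [r ^- 2] enters the weights, and [r ^- 2 * x = z]: the choice of square root disappears. *)
Lemma vertex_weight_sqrt (F : numClosedFieldType) (x z y s : F)
    (i1 j1 i2 j2 : bool) :
  x != 0 -> z != 0 ->
  vertex_weight i1 j1 i2 j2 x y (sqrtC (x / z)) s =
  column_weight x z y (s ^- 2 * y) i1 j1 i2 j2.
Proof.
move=> x_neq0 z_neq0.
have rx : sqrtC (x / z) ^- 2 * x = z.
  by rewrite sqrtCK invf_div mulfVK.
case: i1; case: j1; case: i2; case: j2 => //=; rewrite ?rx //.
- by rewrite mulrBr mulr1 [x * _ ^- 2]mulrC rx.
- by rewrite mulrBr mulr1 [y * _ ^- 2]mulrC.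
Qed.

(** * Triangularity of the transfer through one column *)

Section ColumnTransfer.
Variables (F : fieldType) (x z y c n1 n2 : F).
Hypotheses (cx : c - x != 0) (cz : c - z != 0).
Hypotheses (n1_neq0 : n1 != 0) (n2_neq0 : n2 != 0).
Variable v : bool -> bool -> F.

Let step := column_transfer v
  (fun i1 j1 i2 j2 => column_weight x z y c i1 j1 i2 j2 / n1)
  (fun i1 j1 i2 j2 => column_weight z x y c i1 j1 i2 j2 / n2).

(** With the parameters swapped between the rows, the two weights of type (1,0;1,0) are reciprocal,
    which gives the 1 at equal occupations. At a created particle, (1,0) and (0,1) reach (0,0) with
    the same coefficient, so only their sum enters. *)
Lemma column_transfer00 (t r : bool) :
  step t r false false =
  (t == r)%:R / (n1 * n2) * v false false +
  (~~ t && r)%:R * ((c - y) / (c - z) / (n1 * n2)) * (v true false + v false true).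
Proof.
rewrite /step /column_transfer !big_bool.
by case: t; case: r => /=; field; rewrite ?n1_neq0 ?n2_neq0 ?cx ?cz.
Qed.

(** At unequal occupations, (0,0) and (1,1) feed the coordinates (1,0) and (0,1) with opposite
    coefficients, which cancel in the sum. The factor [(-1) ^+ t] is the source of the fermionic
    sign. *)
Lemma column_transfer_sum (t r : bool) :
  step t r true false + step t r false true =
  (t == r)%:R * (-1) ^+ t * ((z - y) / (z - c) / (n1 * n2)) *
  (v true false + v false true).
Proof.
have zc : z - c != 0 by rewrite -opprB oppr_eq0.
rewrite /step /column_transfer !big_bool.
by case: t; case: r => /=; field; rewrite ?n1_neq0 ?n2_neq0 ?cx ?cz ?zc.
Qed.

Hypotheses (v_anti : v false true = - v true false) (v11 : v true true = 0).

Lemma column_transfer_anti00 (t r : bool) :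
  step t r false false = (t == r)%:R / (n1 * n2) * v false false.
Proof. by rewrite column_transfer00 v_anti subrr mulr0 addr0. Qed.

Lemma column_transfer_anti10 (t r : bool) :
  step t r true false =
  (t == r)%:R * (-1) ^+ t * ((x - y) / (x - c) / (n1 * n2)) * v true false +
  (t && ~~ r)%:R * ((z - x) / (c - x) / (n1 * n2)) * v false false.
Proof.
have xc : x - c != 0 by rewrite -opprB oppr_eq0.
rewrite /step /column_transfer !big_bool.
by case: t; case: r => /=; rewrite ?v_anti ?v11; field;
  rewrite ?n1_neq0 ?n2_neq0 ?cx ?cz ?xc.
Qed.

Lemma column_transfer_anti01 (t r : bool) :
  step t r false true = - step t r true false.
Proof.
rewrite /step /column_transfer !big_bool.
by case: t; case: r => /=; rewrite ?v_anti ?v11; field;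
  rewrite ?n1_neq0 ?n2_neq0 ?cx ?cz.
Qed.

(** The coordinates (1,0) and (0,1) reach (1,1) with equal coefficients, so an antisymmetric vector
    contributes nothing there. *)
Lemma column_transfer_anti11 (t r : bool) : step t r true true = 0.
Proof.
rewrite /step /column_transfer !big_bool.
by case: t; case: r => /=; rewrite ?v_anti ?v11; field;
  rewrite ?n1_neq0 ?n2_neq0 ?cx ?cz.
Qed.

End ColumnTransfer.

(** * Signs and inhomogeneous powers on a window *)

Lemma prod_nat_split (F : fieldType) (f : nat -> F) (k L : nat) : (k < L)%N ->
  \prod_(0 <= i < L) f i =
  \prod_(0 <= i < k) f i * f k * \prod_(k.+1 <= i < L) f i.
Proof.
move=> kL; rewrite (big_cat_nat (n := k)) //=; last exact: ltnW.
by rewrite [X in _ * X]big_ltn //= mulrA.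
Qed.

(** Variation of constants: the index [k] is the column at which the first sequence feeds the
    second, with factors [a] before it and [d] after it. *)
Lemma linear_recurrence (F : fieldType) (P Q a b d : nat -> F) (L : nat) :
  P 0%N = 1 -> Q 0%N = 0 -> (forall k, P k.+1 = a k * P k) ->
  (forall k, Q k.+1 = d k * Q k + b k * P k) ->
  Q L = \sum_(k < L)
    \prod_(0 <= i < k) a i * b k * \prod_(k.+1 <= i < L) d i.
Proof.
move=> P0 Q0 PS QS.
have P_prod k : P k = \prod_(0 <= i < k) a i.
  by elim: k => [|k IHk]; rewrite ?big_nil // big_nat_recr //= PS IHk mulrC.
elim: L => [|L IHL]; first by rewrite big_ord0.
rewrite QS IHL P_prod mulr_sumr big_ord_recr /= (big_geq (m := L.+1)) // mulr1.
rewrite [b L * _]mulrC.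
congr (_ + _); apply: eq_bigr => k _.
by rewrite [in RHS]big_nat_recr //= mulrCA !mulrA -!mulrA [d L * _]mulrC.
Qed.

(** Confinement to the window makes [A] finite; [fset_set] would carry no information on an infinite
    set. *)
Lemma card_window (N L : nat) (A : set int) :
  (forall m : int, A m -> - N%:Z < m <= L%:Z - N%:Z) ->
  #|` fset_set A| = (\sum_(0 <= i < L) (site N i \in A))%N.
Proof.
move=> A_sub; pose S := [seq site N i | i <- iota 0 L & site N i \in A].
have memS : A = [set` S].
  apply/seteqP; split=> m /=.
    move=> Am; have /andP[m_gt m_le] := A_sub m Am.
    have [k kL m_site] := siteP N L m m_gt m_le; subst m.
    apply: map_f; rewrite mem_filter mem_iota leq0n add0n kL !andbT.
    exact: mem_set.
  by move=> /mapP[k]; rewrite mem_filter => /andP[/set_mem kA _] ->.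
have finA : finite_set A by rewrite memS; apply: finite_seq.
have -> : fset_set A = seq_fset tt S.
  apply/fsetP => m; rewrite in_fset_set // seq_fsetE.
  apply/idP/idP => [/set_mem|m_in]; first by rewrite {1}memS.
  by apply: mem_set; rewrite memS.
rewrite size_seq_fset undup_id; last first.
  by rewrite map_inj_uniq ?filter_uniq ?iota_uniq //; apply: site_inj.
by rewrite size_map size_filter -sum1_count big_mkcond /= /index_iota subn0.
Qed.

Lemma fermion_sign_window (F : numClosedFieldType) (N L k : nat) (T : fock_state) :
  windowed N L T ->
  fermion_sign F (site N k) T = \prod_(k.+1 <= i < L) (-1) ^+ occ_at N T i.
Proof.
move=> [T_lo T_hi]; rewrite /fermion_sign (card_window N L); last first.
  move=> m [/= /mem_set m_in]; rewrite /site => m_gt.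
  apply/andP; split; first by lia.
  by rewrite leNgt; apply: contraL m_in; apply: T_hi.
rewrite prodrXr; congr (_ ^+ _).
rewrite [RHS](big_nat_widenl _ 0) // [RHS]big_mkcond /=; apply: eq_bigr => i _.
rewrite /occ_at in_setI; set b := (X in _ && X); have -> : b = (k < i)%N.
  by apply/idP/idP => [/set_mem|lt_ki]; [|apply: mem_set]; rewrite /= /site; lia.
by case: ifP; rewrite ?andbT ?andbF.
Qed.

Lemma charge_window (N L : nat) (T : fock_state) : (N <= L)%N -> windowed N L T ->
  charge T = (\sum_(0 <= i < L) occ_at N T i)%N%:Z - N%:Z.
Proof.
move=> NL [T_lo T_hi]; rewrite /charge !(card_window N L).
- have countN : (\sum_(0 <= i < L) (i < N)%N)%N = N.
    rewrite (big_cat_nat (n := N)) //= [X in (_ + X)%N]big_nat_cond.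
    rewrite [X in (_ + X)%N]big1 => [|i]; last by rewrite andbT; lia.
    rewrite addn0 big_nat_cond (eq_bigr (fun=> 1%N)); last by move=> i; lia.
    by rewrite -big_nat_cond sum_nat_const_nat muln1 subn0.
  (* The identity holds site by site: a site at most 0 counts once on the left, and on the right
     once as a particle or as a hole; a positive site counts its particle on both sides. *)
  have : ((\sum_(0 <= i < L) (site N i \in occ T `&` [set t | (0 < t)%R])) + N =
          (\sum_(0 <= i < L) occ_at N T i) +
          \sum_(0 <= i < L) (site N i \in [set t | (t <= 0)%R] `\` occ T))%N.
    rewrite -[X in (_ + X = _)%N]countN -!big_split; apply: eq_bigr => i _ /=.
    rewrite in_setI in_setD /occ_at.
    have -> : (site N i \in [set t : int | 0 < t]) = (N <= i)%N.
      by apply/idP/idP => [/set_mem|le]; [|apply: mem_set]; rewrite /= /site; lia.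
    have -> : (site N i \in [set t : int | t <= 0]) = (i < N)%N.
      by apply/idP/idP => [/set_mem|le]; [|apply: mem_set]; rewrite /= /site; lia.
    by rewrite ltnNge; case: (_ <= _)%N; case: (_ \in _).
  have arith (p q r n : nat) : (p + n = r + q)%N -> p%:Z - q%:Z = r%:Z - n%:Z.
    by lia.
  exact: arith.
- move=> m [/= m_le m_notin]; apply/andP; split; last by lia.
  by rewrite ltNge; apply/negP => /T_lo /set_mem.
- move=> m [/= /mem_set m_in m_gt]; apply/andP; split; first by lia.
  by rewrite leNgt; apply: contraL m_in; apply: T_hi.
Qed.

Lemma charge_sign_window (F : numClosedFieldType) (N L : nat) (T : fock_state) :
  (N <= L)%N -> windowed N L T ->
  (-1) ^ charge T = \prod_(0 <= i < L) (-1) ^+ occ_at N T i * (-1) ^+ N :> F.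
Proof.
move=> NL T_win; rewrite (charge_window N L) // expfzDr ?oppr_eq0 ?oner_eq0 //.
by rewrite prodrXr -exprnN -exprVn invrN1.
Qed.

(** The left side is the product of indicators left by the recurrence; outside the window [T] and
    [R] agree anyway, so it detects a change at site [k] alone. Creation is [b = true], annihilation
    [b = false]. *)
Lemma hop_indicator (F : numDomainType) (N L k : nat) (T R : fock_state)
    (b : bool) :
  windowed N L T -> windowed N L R -> (k < L)%N ->
  \prod_(0 <= i < k) (occ_at N T i == occ_at N R i)%:R *
  ((occ_at N T k == ~~ b) && (occ_at N R k == b))%:R *
  \prod_(k.+1 <= i < L) (occ_at N T i == occ_at N R i)%:R =
  ((occ_at N T k == ~~ b) && (R == set_site (site N k) T b))%:R :> F.
Proof.
move=> [T_lo T_hi] [R_lo R_hi] kL.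
have [->|R_neq] := eqVneq R (set_site (site N k) T b).
  rewrite big_nat_cond big1 => [|i]; last first.
    by rewrite andbT occ_at_set_site => /andP[_ ik]; rewrite ltn_eqF ?eqxx.
  rewrite [X in _ * X]big_nat_cond [X in _ * X]big1 => [|i]; last first.
    by rewrite andbT occ_at_set_site => /andP[ik _]; rewrite gtn_eqF ?eqxx.
  by rewrite occ_at_set_site !eqxx mul1r mulr1.
rewrite andbF; apply/eqP; apply: contraNT R_neq.
rewrite !mulf_eq0 !negb_or !prodf_seq_neq0 => /andP[/andP[/allP lt_k]].
rewrite pnatr_eq0 eqb0 negbK => /andP[_ /eqP rk] /allP gt_k.
apply/eqP/fock_state_eqP => m; rewrite mem_set_site.
have [m_le|m_gt] := lerP m (- N%:Z).
  by rewrite ifF ?T_lo ?R_lo //; rewrite /site; lia.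
have [m_le|m_gt2] := lerP m (L%:Z - N%:Z); last first.
  rewrite ifF ?(negbTE (T_hi _ m_gt2)) ?(negbTE (R_hi _ m_gt2)) //.
  by move: m_gt2; rewrite /site; lia.
have [i iL ->] := siteP N L m m_gt m_le.
rewrite (inj_eq (@site_inj N)); case: ltngtP => [ik|ki|->] //.
- have := lt_k i; rewrite mem_index_iota ik => /(_ isT).
  by rewrite /= pnatr_eq0 eqb0 negbK => /eqP.
- have := gt_k i; rewrite mem_index_iota ki iL => /(_ isT).
  by rewrite /= pnatr_eq0 eqb0 negbK => /eqP.
Qed.

Lemma psiE (F : numClosedFieldType) (j : int) (T R : fock_state) :
  psi F j T R =
  ((j \notin occ T) && (R == set_site j T true))%:R * fermion_sign F j T.
Proof.
rewrite /psi; set P := asbool _.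
suff -> : P = (j \notin occ T) && (R == set_site j T true).
  by case: ifP; rewrite ?mul1r ?mul0r.
apply/asboolP/andP => [[j_out eqR]|[/negP j_out /eqP ->]]; split.
- by apply/negP => /set_mem.
- apply/eqP/fock_state_eqP => m; rewrite eqR mem_set_site in_setU.
  have [->|m_neq] := eqVneq; first by rewrite (mem_set (_ : [set j] j)) ?orbT.
  by rewrite [X in _ || X](_ : _ = false) ?orbF //; apply/memNset/eqP.
- by move=> /mem_set.
- apply/seteqP; split=> m /=.
    by case: eqVneq => [->|_ /set_mem]; [right|left].
  by case=> [/mem_set ->|->]; [case: ifP|rewrite eqxx].
Qed.

Lemma psi_starE (F : numClosedFieldType) (j : int) (T R : fock_state) :
  psi_star F j T R =
  ((j \in occ T) && (R == set_site j T false))%:R * fermion_sign F j T.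
Proof.
rewrite /psi_star; set P := asbool _.
suff -> : P = (j \in occ T) && (R == set_site j T false).
  by case: ifP; rewrite ?mul1r ?mul0r.
apply/asboolP/andP => [[j_in eqR]|[/set_mem j_in /eqP ->]]; split=> //.
- exact: mem_set.
- apply/eqP/fock_state_eqP => m; rewrite eqR mem_set_site in_setD.
  have [->|m_neq] := eqVneq; first by rewrite (mem_set (_ : [set j] j)) ?andbF.
  by rewrite (_ : (m \in [set j]) = false) ?andbT //; apply/memNset/eqP.
- apply/seteqP; split=> m /=.
    by case: eqVneq => [//|m_neq /set_mem Tm]; split=> //; apply/eqP.
  by move=> [/mem_set Tm /eqP/negbTE ->].
Qed.

(** Since [site N N] is 1, the power based at 0 is a quotient of two products starting at the left
    end of the window. This form covers all cases of the definition at once; only factors at sites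
    at most 0 are cancelled. *)
Lemma inhom_pow_window (F : numClosedFieldType) (N k : nat) (u : F)
    (b c : int -> F) :
  (forall i, (i < N)%N -> u - b (site N i) != 0) ->
  (forall i, (i < N)%N -> u - c (site N i) != 0) ->
  inhom_pow 0 (site N k - 1) u b c =
  \prod_(0 <= i < k) ((u - b (site N i)) / (u - c (site N i))) /
  \prod_(0 <= i < N) ((u - b (site N i)) / (u - c (site N i))).
Proof.
move=> ub uc; set g := fun i : nat => (u - b (site N i)) / (u - c (site N i)).
have g_neq0 m n : (n <= N)%N -> \prod_(m <= i < n) g i != 0.
  move=> nN; rewrite prodf_seq_neq0; apply/allP => i; rewrite mem_index_iota.
  by move=> /andP[_ i_lt]; rewrite /= mulf_neq0 ?invr_eq0 ?ub ?uc ?(leq_trans i_lt).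
have prod_shift m n : \prod_(m <= i < n) g i = \prod_(i < n - m) g (i + m)%N.
  by rewrite -{1}[m]add0n big_addn big_mkord.
rewrite /inhom_pow; have [Nk|kN] := leqP N k.
  rewrite ifT; last by rewrite /site; lia.
  rewrite [in RHS](big_cat_nat (n := N)) //= [_ * _ / _]mulrAC divff ?g_neq0 //.
  rewrite mul1r prod_shift.
  have -> : `|(site N k - 1 - 0)%R|%N = (k - N)%N by rewrite /site; lia.
  apply: eq_bigr => i _; rewrite /g.
  by have -> : site N (i + N) = 0 + 1 + i%:Z by rewrite /site; lia.
rewrite ifF; last by rewrite /site; lia.
rewrite [X in _ / X](big_cat_nat (n := k)) ?(ltnW kN) //=.
rewrite invfM mulrA divff ?g_neq0 ?(ltnW kN) // mul1r prod_shift -prodfV.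
have -> : `|(0 - (site N k - 1))%R|%N = (N - k)%N by rewrite /site; lia.
apply: eq_bigr => i _; rewrite /g invf_div.
by have -> : site N (i + k) = site N k - 1 + 1 + i%:Z by rewrite /site; lia.
Qed.

(** * The two fermionic fields *)

Lemma row_norm_sqrt (F : numClosedFieldType) (X : row_kind) (m : int)
    (x z y s : F) : x != 0 -> z != 0 ->
  row_norm X m x y (sqrtC (x / z)) s =
  match X with
  | RowB => if m <= 0 then (s ^- 2 * y - z) / (s ^- 2 * y - x)
            else (y - x) / (s ^- 2 * y - x)
  | RowC => if m <= 0 then (z - y) / (s ^- 2 * y - x) else 1
  | RowD => if m <= 0 then (s ^- 2 * y - z) / (s ^- 2 * y - x) else 1
  end.
Proof. by move=> x_neq0 z_neq0; rewrite /row_norm !vertex_weight_sqrt. Qed.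

Lemma normalized_weight_sqrt (F : numClosedFieldType) (y s : int -> F)
    (X : row_kind) (x z : F) (N k : nat) : x != 0 -> z != 0 ->
  normalized_weight y s X x (sqrtC (x / z)) N k =
  fun i1 j1 i2 j2 =>
    column_weight x z (y (site N k)) (s (site N k) ^- 2 * y (site N k))
      i1 j1 i2 j2 /
    row_norm X (site N k) x (y (site N k)) (sqrtC (x / z)) (s (site N k)).
Proof.
move=> x_neq0 z_neq0; do 4 (apply/funext => ?).
by rewrite /normalized_weight vertex_weight_sqrt.
Qed.

Lemma site_le0 (N k : nat) : (site N k <= 0) = (k < N)%N.
Proof. by rewrite /site; lia. Qed.

Section Fermions.
Variables (F : numClosedFieldType) (y s : int -> F).
Let c (m : int) : F := s m ^- 2 * y m.

(** The pair of edges enters as (1,0) and leaves as (0,0). Sites left of [j] contribute [g] and a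
    sign, sites right of it 1; the total normalization divides by the product of [g] over the sites
    at most 0, leaving the power based at 0. *)
Lemma Psi_expansion (u xi : F) (T R : fock_state) :
  u != 0 -> xi != 0 ->
  (forall m : int, u - c m != 0) -> (forall m : int, xi - c m != 0) ->
  (forall m : int, m <= 0 -> u - y m != 0) ->
  Psi y s u xi T R =
  \sum_(j \in [set: int])
    (y j * (1 - (s j) ^- 2) / (u - c j) * inhom_pow 0 (j - 1) u y c * psi F j T R).
Proof.
move=> u_neq0 xi_neq0 uc xic uy.
have cu m : c m - u != 0 by rewrite -opprB oppr_eq0.
have cxi m : c m - xi != 0 by rewrite -opprB oppr_eq0.
have [N [N_gt0 T_win R_win]] := windowed_common T R.
pose L := (N + N)%N; have NL : (0 < N <= L)%N by rewrite N_gt0 leq_addr.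
pose n1 k := row_norm RowC (site N k)
  xi (y (site N k)) (sqrtC (xi / u)) (s (site N k)).
pose n2 k := row_norm RowD (site N k)
  u (y (site N k)) (sqrtC (u / xi)) (s (site N k)).
have normC m : row_norm RowC m xi (y m) (sqrtC (xi / u)) (s m) != 0.
  rewrite row_norm_sqrt //; case: ifP => m_le; last exact: oner_neq0.
  by rewrite mulf_neq0 ?invr_eq0 ?cxi ?uy.
have normD m : row_norm RowD m u (y m) (sqrtC (u / xi)) (s m) != 0.
  rewrite row_norm_sqrt //; case: ifP => m_le; last exact: oner_neq0.
  by rewrite mulf_neq0 ?invr_eq0 ?cxi ?cu.
pose n k := n1 k * n2 k.
have n_neq0 k : n k != 0 by rewrite mulf_neq0 ?normC ?normD.
pose g k := (u - y (site N k)) / (u - c (site N k)).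
(* For sites at most 0 the C and D normalizations combine to the eigenvalue [g] up to sign. The
   resulting [(-1) ^+ N] is compensated by the one in [charge_sign_window]. *)
have nE k : n k = if (k < N)%N then - g k else 1.
  rewrite /n /n1 /n2 !row_norm_sqrt // site_le0 /g.
  case: ifP => _; last by rewrite mulr1.
  have := cu (site N k); have := cxi (site N k); have := uc (site N k).
  rewrite /c; move: (_ ^- 2 * _) => ck h1 h2 h3; field; by rewrite h1 h2 h3.
have prod_n : \prod_(0 <= i < L) n i =
    (-1) ^+ N * \prod_(0 <= i < N) g i.
  rewrite (big_cat_nat (n := N)) ?leq_addr //= [X in _ * X]big_nat_cond.
  rewrite [X in _ * X]big1 => [|i]; last first.
    by rewrite andbT => /andP[Ni _]; rewrite nE ltnNge Ni.
  rewrite mulr1 (eq_big_nat _ _ (F2 := fun i => -1 * g i)) => [|i /andP[_ i_lt]].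
    by rewrite big_split prodr_const_nat subn0.
  by rewrite nE i_lt mulN1r.
have prod_neq0 k k' : \prod_(k <= i < k') n i != 0.
  by rewrite prodf_seq_neq0; apply/allP => i _; apply: n_neq0.
rewrite /Psi (fock_comp_window _ _ _ _ _ _ _ normC normD N L) //=.
pose v := two_row_sum (normalized_weight y s RowC xi (sqrtC (xi / u)) N)
  (normalized_weight y s RowD u (sqrtC (u / xi)) N) N
  (occ_at N T) (occ_at N R) true false.
pose same k := (occ_at N T k == occ_at N R k)%:R : F.
have vS k e e' : v k.+1 e e' = column_transfer (v k)
    (fun i1 j1 i2 j2 =>
       column_weight xi u (y (site N k)) (c (site N k)) i1 j1 i2 j2 / n1 k)
    (fun i1 j1 i2 j2 =>
       column_weight u xi (y (site N k)) (c (site N k)) i1 j1 i2 j2 / n2 k)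
    (occ_at N T k) (occ_at N R k) e e'.
  by rewrite /v two_row_sumS !normalized_weight_sqrt.
pose b k := (c (site N k) - y (site N k)) / (c (site N k) - u).
rewrite -[two_row_sum _ _ _ _ _ _ _ _ _ _]/(v L false false).
(* The eigenfunctional feeds the coordinate (0,0), at the site where a particle is created. *)
have -> := linear_recurrence F (fun k => v k true false + v k false true)
  (fun k => v k false false)
  (fun k => same k * (-1) ^+ occ_at N T k * (g k / n k))
  (fun k => (~~ occ_at N T k && occ_at N R k)%:R * (b k / n k))
  (fun k => same k / n k) L.
- rewrite (@fsbig_site _ _ _ N L) => [|m m_le|m m_gt].
  + rewrite mulr_sumr; apply: eq_bigr => k _.
    have kL : (k < L)%N by [].
    have powE : inhom_pow 0 (site N k - 1) u y c =
        \prod_(0 <= i < k) g i / \prod_(0 <= i < N) g i.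
      by apply: inhom_pow_window => i iN; [apply: uy; rewrite site_le0|apply: uc].
    have coefE : y (site N k) * (1 - s (site N k) ^- 2) / (u - c (site N k)) = b k.
      rewrite /b -[c _ - u]opprB invrN mulrN -mulNr opprB /c.
      by rewrite mulrBr mulr1 [y _ * _ ^- 2]mulrC.
    rewrite powE coefE psiE (fermion_sign_window F N L) //.
    have ind := hop_indicator F N L k T R true T_win R_win kL.
    have -> : (site N k \notin occ T) && (R == set_site (site N k) T true) =
        (occ_at N T k == ~~ true) && (R == set_site (site N k) T true).
      by rewrite /occ_at eqbF_neg.
    rewrite -ind eqbF_neg eqb_id.
    have [tk|tk] := boolP (occ_at N T k); first by rewrite !(mulr0, mul0r).
    rewrite (charge_sign_window F N L) //; last by case/andP: NL.
    rewrite (prod_nat_split F _ k L kL) (negbTE tk) expr0 mulr1.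
    have gN : \prod_(0 <= i < N) g i = (-1) ^+ N * \prod_(0 <= i < L) n i.
      by rewrite prod_n mulrA -expr2 sqrr_sign mul1r.
    (* The recurrence collects the signs left of [k], whereas [psi] needs those on its right. The
       charge sign runs over the whole window, so the left signs square to 1 and the right ones
       remain. *)
    have sq1 : \prod_(0 <= i < k) (-1) ^+ occ_at N T i *
               \prod_(0 <= i < k) (-1) ^+ occ_at N T i = 1 :> F.
      by rewrite prodrXr -expr2 sqrr_sign.
    rewrite gN (prod_nat_split F _ k L kL) [((-1) ^+ N * _)^-1]invfM invr_sign.
    clearbody g b n; rewrite /same !big_split /= !prodfV.
    rewrite -[RHS]mul1r -[X in _ = X * _]sq1.
    have := prod_neq0 0%N k; have := prod_neq0 k.+1 L; have := n_neq0 k.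
    move: (\prod_(0 <= i < k) n i) (\prod_(k.+1 <= i < L) n i) (n k) => A B nk.
    move=> nk0 B0 A0; field; by rewrite A0 B0 nk0.
  (* Creation is impossible below the window, where [T] is full, and above it, where [R] is
     empty. *)
  + by rewrite psiE T_win.1 // mul0r mulr0.
  + rewrite psiE; case: eqVneq => [eqR|]; last by rewrite andbF mul0r mulr0.
    by have := R_win.2 m m_gt; rewrite eqR mem_set_site eqxx.
- by rewrite /v !two_row_sum0 /= mulr1 mulr0 addr0.
- by rewrite /v two_row_sum0 /= mul0r.
- move=> k; rewrite !vS.
  by rewrite (column_transfer_sum _ _ _ _ _ _ _
    (cxi _) (cu _) (normC _) (normD _)).
- move=> k; rewrite vS.
  by rewrite (column_transfer00 _ _ _ _ _ _ _
    (cxi _) (cu _) (normC _) (normD _)).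
Qed.

(** Here the edges enter as (0,0) and leave as (1,0), so [g] and the signs come from the sites right
    of [j]. They already match the sign of [psi_star], and no charge factor is involved. *)
Lemma Psi_star_expansion (zeta w : F) (T R : fock_state) :
  zeta != 0 -> w != 0 ->
  (forall m : int, zeta - c m != 0) -> (forall m : int, w - c m != 0) ->
  (forall m : int, w - y m != 0) ->
  Psi_star y s zeta w T R =
  \sum_(j \in [set: int])
    ((w - zeta) / (w - y j) * inhom_pow 0 (j - 1) w c y * psi_star F j T R).
Proof.
move=> zeta_neq0 w_neq0 zetac wc wy.
have czeta m : c m - zeta != 0 by rewrite -opprB oppr_eq0.
have cw m : c m - w != 0 by rewrite -opprB oppr_eq0.
have yw m : y m - w != 0 by rewrite -opprB oppr_eq0.
have [N [N_gt0 T_win R_win]] := windowed_common T R.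
pose L := (N + N)%N; have NL : (0 < N <= L)%N by rewrite N_gt0 leq_addr.
pose n1 k := row_norm RowB (site N k)
  w (y (site N k)) (sqrtC (w / zeta)) (s (site N k)).
pose n2 k := row_norm RowD (site N k)
  zeta (y (site N k)) (sqrtC (zeta / w)) (s (site N k)).
have normB m : row_norm RowB m w (y m) (sqrtC (w / zeta)) (s m) != 0.
  by rewrite row_norm_sqrt //; case: ifP => m_le;
    rewrite mulf_neq0 ?invr_eq0 ?czeta ?cw ?yw.
have normD m : row_norm RowD m zeta (y m) (sqrtC (zeta / w)) (s m) != 0.
  rewrite row_norm_sqrt //; case: ifP => m_le; last exact: oner_neq0.
  by rewrite mulf_neq0 ?invr_eq0 ?czeta ?cw.
pose n k := n1 k * n2 k.
have n_neq0 k : n k != 0 by rewrite mulf_neq0 ?normB ?normD.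
pose g k := (w - y (site N k)) / (w - c (site N k)).
have g_neq0 k : g k != 0 by rewrite mulf_neq0 ?invr_eq0 ?wy ?wc.
have nE k : n k = if (k < N)%N then 1 else g k.
  rewrite /n /n1 /n2 !row_norm_sqrt // site_le0 /g.
  have := czeta (site N k); have := cw (site N k); have := wc (site N k).
  rewrite /c; move: (_ ^- 2 * _) => ck h1 h2 h3.
  by case: ifP => _; field; rewrite ?h1 ?h2 ?h3.
have prod_n : \prod_(0 <= i < N) g i * \prod_(0 <= i < L) n i =
    \prod_(0 <= i < L) g i.
  rewrite !(big_cat_nat (m := 0%N) (n := N) (p := L)) ?leq_addr //=.
  rewrite [X in _ * (X * _)]big_nat_cond [X in _ * (X * _)]big1 => [|i]; last first.
    by rewrite andbT => /andP[_ iN]; rewrite nE iN.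
  rewrite mul1r; congr (_ * _); apply: eq_big_nat => i /andP[Ni _].
  by rewrite nE ltnNge Ni.
have prod_neq0 (f : nat -> F) k k' : (forall i, f i != 0) ->
    \prod_(k <= i < k') f i != 0.
  by move=> f_neq0; rewrite prodf_seq_neq0; apply/allP => i _; apply: f_neq0.
rewrite /Psi_star (fock_comp_window _ _ _ _ _ _ _ normB normD N L) //=.
pose v := two_row_sum (normalized_weight y s RowB w (sqrtC (w / zeta)) N)
  (normalized_weight y s RowD zeta (sqrtC (zeta / w)) N) N (occ_at N T) (occ_at N R)
  false false.
pose same k := (occ_at N T k == occ_at N R k)%:R : F.
have vS k e e' : v k.+1 e e' = column_transfer (v k)
    (fun i1 j1 i2 j2 =>
       column_weight w zeta (y (site N k)) (c (site N k)) i1 j1 i2 j2 / n1 k)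
    (fun i1 j1 i2 j2 =>
       column_weight zeta w (y (site N k)) (c (site N k)) i1 j1 i2 j2 / n2 k)
    (occ_at N T k) (occ_at N R k) e e'.
  by rewrite /v two_row_sumS !normalized_weight_sqrt.
(* The initial vector is supported at (0,0), and each column preserves the two properties
   jointly. *)
have [v_anti v11] : (forall k, v k false true = - v k true false) /\
    (forall k, v k true true = 0).
  apply/all_and2 => k; elim: k => [|k [v_anti v11]].
    by rewrite /v !two_row_sum0 /= !mul0r mulr0 oppr0.
  rewrite !vS.
  by rewrite (column_transfer_anti01 _ _ _ _ _ _ _
      (cw _) (czeta _) (normB _) (normD _))
    ?(column_transfer_anti11 _ _ _ _ _ _ _ (cw _) (czeta _) (normB _) (normD _)).
pose b k := (zeta - w) / (c (site N k) - w).
rewrite -[two_row_sum _ _ _ _ _ _ _ _ _ _]/(v L true false).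
have -> := linear_recurrence F (fun k => v k false false) (fun k => v k true false)
  (fun k => same k / n k)
  (fun k => (occ_at N T k && ~~ occ_at N R k)%:R * (b k / n k))
  (fun k => same k * (-1) ^+ occ_at N T k * (g k / n k)) L.
- rewrite (@fsbig_site _ _ _ N L) => [|m m_le|m m_gt].
  + apply: eq_bigr => k _; have kL : (k < L)%N by [].
    have powE : inhom_pow 0 (site N k - 1) w c y =
        \prod_(0 <= i < N) g i / \prod_(0 <= i < k) g i.
      rewrite inhom_pow_window => [|i _|i _] //.
      have prod_inv m :
          \prod_(0 <= i < m) ((w - c (site N i)) / (w - y (site N i))) =
          (\prod_(0 <= i < m) g i)^-1.
        by rewrite -prodfV; apply: eq_bigr => i _; rewrite invf_div.
      by rewrite !prod_inv invrK mulrC.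
    (* The product of [g] on the right starts strictly after [j] while the power stops at [j - 1];
       the factor of [g] at [j] itself goes into the coefficient. *)
    have coefE : (w - zeta) / (w - y (site N k)) = b k / g k.
      rewrite /b /g -opprB -[c _ - w]opprB invf_div.
      have := wc (site N k); have := wy (site N k).
      by move: (c _) => ck h1 h2; field; rewrite h1 h2.
    rewrite powE coefE psi_starE (fermion_sign_window F N L) //.
    have ind := hop_indicator F N L k T R false T_win R_win kL.
    have -> : (site N k \in occ T) && (R == set_site (site N k) T false) =
        (occ_at N T k == ~~ false) && (R == set_site (site N k) T false).
      by rewrite /occ_at eqb_id.
    rewrite -ind eqb_id eqbF_neg.
    have := prod_n; rewrite !(prod_nat_split F _ k L kL).
    clearbody g b n; rewrite /same !big_split /= !prodfV.
    have := prod_neq0 n 0%N k n_neq0; have := prod_neq0 n k.+1 L n_neq0.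
    have := prod_neq0 g 0%N k g_neq0; have := n_neq0 k; have := g_neq0 k.
    move: (\prod_(0 <= i < k) n i) (\prod_(k.+1 <= i < L) n i) (n k) => A B nk.
    move: (\prod_(0 <= i < k) g i) (\prod_(k.+1 <= i < L) g i) (g k) => G1 G2 gk.
    move=> gk0 nk0 G10 B0 A0 prodE.
    (* The recurrence gives the product beyond [j], the power the product before it; [prod_n]
       converts one into the other. *)
    have -> : G2 = \prod_(0 <= i < N) g i * (A * nk * B) / (G1 * gk).
      by rewrite prodE; field; rewrite gk0 G10.
    by field; rewrite gk0 nk0 G10 B0 A0.
  + rewrite psi_starE; case: eqVneq => [eqR|]; last by rewrite andbF mul0r mulr0.
    by have := R_win.1 m m_le; rewrite eqR mem_set_site eqxx.
  + by rewrite psi_starE (negbTE (T_win.2 m m_gt)) mul0r mulr0.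
- by rewrite /v two_row_sum0 mulr1.
- by rewrite /v two_row_sum0 mul0r.
- move=> k; rewrite vS.
  by rewrite (column_transfer_anti00 _ _ _ _ _ _ _
    (cw _) (czeta _) (normB _) (normD _)).
- move=> k; rewrite vS.
  by rewrite (column_transfer_anti10 _ _ _ _ _ _ _
    (cw _) (czeta _) (normB _) (normD _)).
Qed.

End Fermions.

(* In each part s_neq0 and the last three hypotheses say that no denominator
   vanishes in the weights, the normalizations and the right-hand side. *)
Theorem theorem1p13 (R : realType) (y s : int -> R[i])
    (s_neq0 : forall m : int, s m != 0) :
  (forall u xi : R[i],
     u != 0 -> xi != 0 ->
     (forall m : int, u - (s m) ^- 2 * y m != 0) ->
     (forall m : int, xi - (s m) ^- 2 * y m != 0) ->
     (forall m : int, m <= 0 -> u - y m != 0) ->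
     forall T S : fock_state,
       Psi y s u xi T S =
       \sum_(j \in [set: int])
         (y j * (1 - (s j) ^- 2) / (u - (s j) ^- 2 * y j) *
          inhom_pow 0 (j - 1) u y (fun k => (s k) ^- 2 * y k) *
          psi R[i] j T S)) /\
  (forall zeta v : R[i],
     zeta != 0 -> v != 0 ->
     (forall m : int, zeta - (s m) ^- 2 * y m != 0) ->
     (forall m : int, v - (s m) ^- 2 * y m != 0) ->
     (forall m : int, v - y m != 0) ->
     forall T S : fock_state,
       Psi_star y s zeta v T S =
       \sum_(j \in [set: int])
         ((v - zeta) / (v - y j) *
          inhom_pow 0 (j - 1) v (fun k => (s k) ^- 2 * y k) y *
          psi_star R[i] j T S)).
Proof.
split=> [u xi u_neq0 xi_neq0 uc xic uy T S|zeta v zeta_neq0 v_neq0 zetac vc vy T S].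
- exact: Psi_expansion.
- exact: Psi_star_expansion.
Qed.
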